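(* Let $\mathfrak V$ be a variety of algebras over a field $\mathbf F$. Then $\mathfrak V$ is nilpotent if and only if the annihilator of every nonzero algebra $A\in\mathfrak V$ is nonzero.
   Context: An algebra over a field $\mathbf F$ is a vector space over $\mathbf F$ with a bilinear multiplication (not assumed associative, commutative or unital). A variety of $\mathbf F$-algebras is the class of all $\mathbf F$-algebras satisfying a given set of polynomial identities $v(x_1,\dots,x_n)=0$, where each $v$ is a nonassociative polynomial over $\mathbf F$ without constant term. For an algebra $A$, put $A^1=A$ and $A^k=\sum_{s+t=k}A^sA^t$, where $LM$ denotes the linear span of all products $lm$, $l\in L$, $m\in M$. $A$ is nilpotent if $A^{c+1}=\{0\}$ for some $c\ge 1$. A variety is nilpotent if every algebra in it is nilpotent. The annihilator of $A$ is $I(A)=\{a\in A : ab=ba=0 \text{ for all } b\in A\}$. *)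

(* Defs.v *)
From mathcomp Require Import all_boot all_order all_algebra.
From mathcomp Require Import boolp classical_sets.

Set Implicit Arguments.
Unset Strict Implicit.
Unset Printing Implicit Defensive.

Import GRing.Theory.

Local Open Scope ring_scope.
Local Open Scope classical_set_scope.

(* An algebra is neither associative, commutative nor unital in general, so
   MathComp's [algType] is not suitable. *)
Record naAlgebra (F : fieldType) := NaAlgebra {
  na_carrier :> lmodType F;
  na_mul : {bilinear na_carrier -> na_carrier -> na_carrier}
}.

Inductive namonom : Type :=
  | Var of nat
  | Mul of namonom & namonom.

(* The list [:: (c_1, m_1); ...; (c_r, m_r)] stands for the polynomial
   c_1 m_1 + ... + c_r m_r; monomials have degree at least one, so there is no
   constant term.  Only finitely many variables occur in each polynomial. *)
Definition napoly (F : fieldType) := seq (F * namonom).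

Section Algebra.

Variables (F : fieldType) (A : naAlgebra F).

Fixpoint eval_monom (e : nat -> A) (m : namonom) : A :=
  match m with
  | Var i => e i
  | Mul m1 m2 => na_mul A (eval_monom e m1) (eval_monom e m2)
  end.

Definition eval_poly (e : nat -> A) (v : napoly F) : A :=
  \sum_(cm <- v) cm.1 *: eval_monom e cm.2.

Definition satisfies (v : napoly F) : Prop :=
  forall e : nat -> A, eval_poly e v = 0.

Inductive span (S : set A) : set A :=
  | span_gen a : S a -> span S a
  | span0 : span S 0
  | spanD a b : span S a -> span S b -> span S (a + b)
  | spanZ c a : span S a -> span S (c *: a).

Definition prod_span (L M : set A) : set A :=
  span [set a | exists l m, [/\ L l, M m & a = na_mul A l m]].

(* [power k] is A^k for k >= 1, and {0} for k = 0; the recursion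
   A^1 = A, A^k = \sum_(s + t = k) A^s A^t is proved in [power1] and [powerE]. *)
Inductive power : nat -> set A :=
  | power_one a : power 1 a
  | power_mul s t a b : (0 < s)%N -> (0 < t)%N ->
      power s a -> power t b -> power (s + t) (na_mul A a b)
  | power_zero k : power k 0
  | power_add k a b : power k a -> power k b -> power k (a + b)
  | power_scale k c a : power k a -> power k (c *: a).

Lemma power1 : power 1 = setT.
Proof. by apply/seteqP; split=> // a _; exact: power_one. Qed.

Lemma powerE k : (1 < k)%N ->
  power k = span (fun a => exists s t, [/\ (0 < s)%N, (0 < t)%N, (s + t = k)%N
                                         & prod_span (power s) (power t) a]).
Proof.
move=> k1; apply/seteqP; split=> a.
- move=> pa; move: pa k1.
  elim=> {k a} [//|s t a b s0 t0 pa _ pb _ _|k _|k a b _ IHa _ IHb k1|k c a _ IHa k1].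
  + by apply: span_gen; exists s, t; split=> //; apply: span_gen; exists a, b.
  + exact: span0.
  + by apply: spanD; [exact: IHa|exact: IHb].
  + by apply: spanZ; exact: IHa.
- elim=> {a} [a [s [t [s0 t0 <-]]]||a b _ IHa _ IHb|c a _ IHa].
  + elim=> {a} [a [l [m [pl pm ->]]]||a b _ IHa _ IHb|c a _ IHa].
    * exact: power_mul.
    * exact: power_zero.
    * exact: power_add.
    * exact: power_scale.
  + exact: power_zero.
  + exact: power_add.
  + exact: power_scale.
Qed.

Definition nilpotent_alg : Prop :=
  exists c : nat, (1 <= c)%N /\ power c.+1 = [set 0].

Definition annihilator : set A :=
  [set a | forall b : A, na_mul A a b = 0 /\ na_mul A b a = 0].

Definition nonzero_alg : Prop := exists a : A, a != 0.

End Algebra.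

Arguments power {F} A k _.
Arguments annihilator {F} A _.

Definition is_variety (F : fieldType) (V : naAlgebra F -> Prop) : Prop :=
  exists Sigma : set (napoly F),
    forall A : naAlgebra F, V A <-> (forall v, Sigma v -> satisfies A v).

Definition nilpotent_variety (F : fieldType) (V : naAlgebra F -> Prop) : Prop :=
  forall A : naAlgebra F, V A -> nilpotent_alg A.

(* Main.v *)
(** The last nonzero power of a nilpotent algebra lies in its annihilator.

    Conversely, in an algebra B, let Z be the closure of 0 under sums, scalars
    and the rule that a lies in Z as soon as all products of a with elements of
    B do.  The quotient B / Z has zero annihilator, so under the annihilator
    condition Z = B for every B in the variety.  By induction on this closure,
    every infinite sequence of one-sided multiplications eventually kills a
    given element of Z.  For A in the variety, apply this to B = A^nat: a
    diagonal argument shows that for each infinite word of sides (left/right)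
    some finite prefix vanishes identically on A.  By König's lemma the length n
    of the prefix can be taken uniform, and then every product of degree at
    least 2^n, having depth at least n, is 0. *)

Require Import Defs.
From HB Require Import structures.
From mathcomp Require Import all_boot all_order all_algebra.
From mathcomp Require Import boolp classical_sets functions.
From mathcomp Require Import zify.

Set Implicit Arguments.
Unset Strict Implicit.
Unset Printing Implicit Defensive.

Import GRing.Theory.
Import Quotient.

Local Open Scope ring_scope.
Local Open Scope classical_set_scope.
Local Open Scope quotient_scope.

(** * Identities pass to homomorphic images *)

Section Morphisms.
Variables (F : fieldType) (A B : naAlgebra F) (f : {linear A -> B}).
Hypothesis fM : forall a b, f (na_mul A a b) = na_mul B (f a) (f b).

Lemma morph_eval_poly (e : nat -> A) (v : napoly F) :
  f (eval_poly e v) = eval_poly (f \o e) v.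
Proof.
have fmon m : f (eval_monom e m) = eval_monom (f \o e) m.
  by elim: m => //= m1 IH1 m2 IH2; rewrite fM IH1 IH2.
by rewrite linear_sum; apply: eq_bigr => cm _; rewrite linearZ fmon.
Qed.

Lemma satisfies_surj (v : napoly F) :
  (forall y, exists x, f x = y) -> satisfies A v -> satisfies B v.
Proof.
move=> /choice[g gK] Av e; have -> : e = f \o (g \o e) by apply/funext=> i /=.
by rewrite -morph_eval_poly Av linear0.
Qed.

End Morphisms.

(** * Quotient of an algebra by a two-sided ideal *)

Section Quotient.
Variables (F : fieldType) (A : naAlgebra F) (I : set A).
Hypotheses (I0 : I 0) (ID : forall a b, I a -> I b -> I (a + b))
  (IZ : forall c a, I a -> I (c *: a))
  (IM : forall a b, I a -> I (na_mul A a b) /\ I (na_mul A b a)).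

(** Only a surjective homomorphism with kernel [I] is exported, so later arguments never see coset
    representatives. *)
Lemma quotient_algebra : exists (B : naAlgebra F) (p : {linear A -> B}),
  [/\ forall y, exists x, p x = y,
      forall a b, p (na_mul A a b) = na_mul B (p a) (p b) &
      forall a, p a = 0 <-> I a].
Proof.
have [J JP] : exists J : zmodClosed A, forall a, a \in J <-> I a.
  pose pI : {pred A} := fun a => `[< I a >].
  have pI_closed : zmod_closed pI.
    split=> [|a b /asboolP Ia /asboolP Ib]; apply/asboolP => //.
    by apply: ID => //; rewrite -scaleN1r; exact: IZ.
  pose mJ := GRing.isZmodClosed.Build A pI pI_closed.
  by exists (HB.pack pI mJ : zmodClosed A) => a; split=> /asboolP.
pose Q := {quot J}.
have piP x y : \pi_Q x = \pi_Q y <-> I (x - y).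
  split=> [/eqP|/JP Ixy]; first by rewrite -idealrBE => /JP.
  by apply/eqP; rewrite -idealrBE.
have piS (q : Q) : exists x, q = \pi_Q x by exists (repr q); rewrite reprK.
have reprP x : I (repr (\pi_Q x) - x) by apply/piP; rewrite reprK.
pose scale c (q : Q) : Q := \pi_Q (c *: repr q).
have scaleE c x : scale c (\pi_Q x) = \pi_Q (c *: x).
  by apply/piP; rewrite -scalerBr; exact: IZ.
have scaleA a b q : scale a (scale b q) = scale (a * b) q.
  by have [x ->] := piS q; rewrite !scaleE scalerA.
have scale1 : left_id 1 scale.
  by move=> q; have [x ->] := piS q; rewrite scaleE scale1r.
have scaleDr : right_distributive scale +%R.
  move=> c q r; have [[x ->] [y ->]] := (piS q, piS r).
  by rewrite -raddfD !scaleE scalerDr raddfD.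
have scaleDl q : {morph scale^~ q : a b / a + b}.
  by move=> a b; have [x ->] := piS q; rewrite /= !scaleE scalerDl raddfD.
pose mM := GRing.Zmodule_isLmodule.Build F Q scaleA scale1 scaleDr scaleDl.
pose M : lmodType F := HB.pack Q mM.
pose mul (q r : M) : M := \pi_Q (na_mul A (repr (q : Q)) (repr (r : Q))).
have mulE x y : mul (\pi_Q x) (\pi_Q y) = \pi_Q (na_mul A x y).
  (* Independence of representatives: the difference of the two products splits into terms having a
     factor in [I]. *)
  apply/piP; set x' := repr _; set y' := repr _.
  have -> : na_mul A x' y' - na_mul A x y
          = na_mul A (x' - x) y' + na_mul A x (y' - y).
    by rewrite linearBl linearBr addrA subrK.
  by apply: ID; [exact: (IM _ (reprP _)).1|exact: (IM _ (reprP _)).2].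
have pilin : linear (\pi_Q : A -> M).
  by move=> c x y; rewrite raddfD; congr (_ + _); exact: esym (scaleE c x).
have mulbil : bilinear_for *:%R *:%R mul.
  split=> r c q q'; have [[x ->] [[y ->] [z ->]]] := (piS r, (piS q, piS q')).
    by rewrite -pilin !mulE linearPl pilin.
  by rewrite -pilin !mulE linearPr pilin.
pose mB := bilinear_isBilinear.Build F M M M *:%R *:%R mul mulbil.
pose mulb : {bilinear M -> M -> M} := HB.pack mul mB.
pose mp := GRing.isLinear.Build F A M *:%R (\pi_Q : A -> M) pilin.
pose p : {linear A -> M} := HB.pack (\pi_Q : A -> M) mp.
exists (NaAlgebra mulb), p; split.
- by move=> y; exists (repr (y : Q)); exact: reprK.
- by move=> a b; rewrite /= -mulE.
- by move=> a; rewrite -[a in I a]subr0 -piP [\pi_Q 0]raddf0.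
Qed.

End Quotient.

(** * The transfinite upper annihilator series and words of one-sided multiplications *)

Section UpperAnnihilator.
Variables (F : fieldType) (A : naAlgebra F).

(** The limit of the transfinite upper annihilator series; the inductive closure avoids ordinals. *)
Inductive hyperannihilator : set A :=
  | hyper0 : hyperannihilator 0
  | hyperD a b : hyperannihilator a -> hyperannihilator b ->
      hyperannihilator (a + b)
  | hyperZ c a : hyperannihilator a -> hyperannihilator (c *: a)
  | hyper_step a :
      (forall b, hyperannihilator (na_mul A a b)) ->
      (forall b, hyperannihilator (na_mul A b a)) -> hyperannihilator a.

Lemma hyperannihilator_ideal a b : hyperannihilator a ->
  hyperannihilator (na_mul A a b) /\ hyperannihilator (na_mul A b a).
Proof.
elim=> {a} [|a a' _ [al ar] _ [al' ar']|c a _ [al ar]|a al _ ar _].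
- by rewrite linear0l linear0r; split; exact: hyper0.
- by rewrite linearDl linearDr; split; exact: hyperD.
- by rewrite linearZl_LR linearZr_LR; split; exact: hyperZ.
- by split; [exact: al|exact: ar].
Qed.

Definition one_sided (a : A) (s : bool * A) : A :=
  if s.1 then na_mul A a s.2 else na_mul A s.2 a.

Lemma one_sided_linear s : linear (one_sided^~ s).
Proof.
by case: s => -[] b c x y; rewrite /one_sided /= ?linearPl ?linearPr.
Qed.

Lemma foldl_one_sided_linear t : linear (fun a => foldl one_sided a t).
Proof.
move=> c; elim: t => //= s t IHt x y.
by rewrite one_sided_linear IHt.
Qed.

Lemma foldl_one_sided0 t : foldl one_sided 0 t = 0.
Proof.
have := foldl_one_sided_linear t (-1) 0 0.
by rewrite scaler0 addr0 scaleN1r addNr.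
Qed.

Definition multipliers (w : nat -> bool * A) n := [seq w i | i <- iota 0 n].

Lemma foldl_multipliers0 a w m n : (m <= n)%N ->
  foldl one_sided a (multipliers w m) = 0 ->
  foldl one_sided a (multipliers w n) = 0.
Proof.
move=> /subnKC <-; rewrite /multipliers iotaD map_cat foldl_cat => ->.
exact: foldl_one_sided0.
Qed.

Lemma hyperannihilator_finite a (w : nat -> bool * A) : hyperannihilator a ->
  exists n, foldl one_sided a (multipliers w n) = 0.
Proof.
move=> Za; elim: Za w => {a} [|a b _ IHa _ IHb|c a _ IHa|a _ IHl _ IHr] w.
- by exists 0%N.
- have [[m am0] [n bn0]] := (IHa w, IHb w).
  exists (maxn m n); rewrite -[a]scale1r foldl_one_sided_linear.
  by rewrite !(foldl_multipliers0 _ am0, foldl_multipliers0 _ bn0)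
             ?leq_maxl ?leq_maxr // scaler0 addr0.
- have [n an0] := IHa w.
  exists n; rewrite -[c *: a]addr0 foldl_one_sided_linear an0.
  by rewrite foldl_one_sided0 scaler0 addr0.
(* The first letter of [w] turns [a] into a product, to which induction applies with the shifted
   sequence. *)
- have [n wn0] : exists n,
      foldl one_sided (one_sided a (w 0%N)) (multipliers (w \o succn) n) = 0.
    by rewrite /one_sided; case: (w 0%N).1; [exact: IHl|exact: IHr].
  by exists n.+1; rewrite /multipliers /= (iotaDl 1) -map_comp.
Qed.

(** Only the sides are recorded: the words then form a binary tree, as König's lemma requires. *)
Definition vanishing (s : seq bool) :=
  forall a t, map fst t = s -> foldl one_sided a t = 0.

Lemma vanishing_cat s s' : vanishing s -> vanishing (s ++ s').
Proof.
move=> s0 a t ts; rewrite -(cat_take_drop (size s) t) foldl_cat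
        (s0 _ (take _ _)) ?foldl_one_sided0 //.
by rewrite map_take ts take_size_cat.
Qed.

Lemma vanishing_uniform :
  (forall w : nat -> bool, exists n, vanishing (mkseq w n)) ->
  exists n, forall s, size s = n -> vanishing s.
Proof.
move=> wvan; apply: contrapT => no_bound.
(* König's lemma for the tree of the words that do not vanish. *)
pose unbounded s := forall n, exists2 s', size s' = n & ~ vanishing (s ++ s').
have unbounded_step s : exists b, unbounded s -> unbounded (rcons s b).
  (* The existential precedes the premise so that choice gives a total [next]; for bounded words
     [true] is a dummy value. *)
  have [ub|nub] := pselect (unbounded s); last by exists true.
  have [ubt|/existsNP[m mt]] := pselect (unbounded (rcons s true)).
    by exists true.
  (* The extra letter is the branch taken. Since prefixes of nonvanishing words do not vanish,
     length at least [m] rules out [true], and length at least [n] serves [false]. *)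
  exists false => _ n; have [s' s'sz s'nv] := ub (maxn m n).+1.
  case: s' s'sz s'nv => // b s' [s'sz] s'nv.
  have nv_take k : (k <= maxn m n)%N ->
      exists2 u, size u = k & ~ vanishing (rcons s b ++ u).
    move=> km; exists (take k s'); first by rewrite size_takel // s'sz.
    move=> /(@vanishing_cat _ (drop k s')).
    by rewrite -catA cat_take_drop cat_rcons.
  case: b {s'nv} nv_take => nv_take; last exact/nv_take/leq_maxr.
  by case: mt; exact/nv_take/leq_maxl.
have [next nextP] := choice unbounded_step.
pose fix pre n := if n is n'.+1 then rcons (pre n') (next (pre n')) else [::].
pose w n := next (pre n).
have preE n : pre n = mkseq w n by elim: n => //= n IHn; rewrite mkseqS -IHn.
have pre_unbounded n : unbounded (pre n).
  elim: n => [n|n IHn]; last exact: nextP.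
  apply: contrapT => nex; apply: no_bound; exists n => s sn.
  by apply: contrapT => snv; apply: nex; exists s.
have [n] := wvan w; rewrite -preE => van.
have [s' _] := pre_unbounded n 0%N; apply; exact: vanishing_cat.
Qed.

Lemma vanishing_nilpotent n :
  (forall s, size s = n -> vanishing s) -> nilpotent_alg A.
Proof.
move=> nvan.
(* [U m] is the m-th term of the upper annihilator series. *)
pose U m : set A := [set a | forall t, size t = m -> foldl one_sided a t = 0].
have pU k j a : (j <= n)%N -> (2 ^ j <= k)%N -> power A k a -> U (n - j)%N a.
  move=> jn jk pa; elim: pa j jn jk => {k a}
    [a|k l a b _ _ _ IHa _ IHb|k|k a b _ IHa _ IHb|k c a _ IHa] [|j] jn jk t tn.
  all: try by apply: (nvan (map fst t)); rewrite ?size_map // tn subn0.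
  + by move: jk; rewrite leqNgt -{1}(expn0 2) ltn_exp2l.
  (* One factor carries at least half of the degree; the other one becomes the first multiplier. *)
  + have [jk'|jl'] : (2 ^ j <= k)%N \/ (2 ^ j <= l)%N.
    * move: jk; rewrite expnS mul2n -addnn.
      by case: (leqP (2 ^ j) k) => [|kj]; [left|right; lia].
    * by apply: (IHa j (ltnW jn) jk' ((true, b) :: t)); rewrite /= tn subnSK.
    * by apply: (IHb j (ltnW jn) jl' ((false, a) :: t)); rewrite /= tn subnSK.
  + exact: foldl_one_sided0.
  + rewrite -[a]scale1r foldl_one_sided_linear.
    by rewrite (IHa j.+1) // (IHb j.+1) // scaler0 addr0.
  + rewrite -[c *: a]addr0 foldl_one_sided_linear (IHa j.+1) //.
    by rewrite scaler0 foldl_one_sided0 addr0.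
(* The power [2 ^ n] is already zero; this choice of [c] stays positive when [n] is 0. *)
exists (2 ^ n)%N; split; first by rewrite expn_gt0.
apply/seteqP; split=> a; last by move=> ->; exact: power_zero.
move=> /(pU _ n) - /(_ (leqnn n) (leqnSn _)); rewrite subnn.
by move=> /(_ [::] erefl).
Qed.

End UpperAnnihilator.

(** * Countable powers and the diagonal argument *)

Section CountablePower.
Variables (F : fieldType) (A : naAlgebra F).

Definition pointwise_mul (f g : nat -> A) : nat -> A :=
  fun i => na_mul A (f i) (g i).

Lemma pointwise_mul_bilinear : bilinear_for *:%R *:%R pointwise_mul.
Proof.
by split=> h c f g; apply/funext => i; [exact: linearPl|exact: linearPr].
Qed.

HB.instance Definition _ := bilinear_isBilinear.Build F _ _ _ *:%R *:%R
  pointwise_mul pointwise_mul_bilinear.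

Definition countable_power : naAlgebra F := NaAlgebra pointwise_mul.

Definition coordinate (i : nat) (f : countable_power) : A := f i.

HB.instance Definition _ i := GRing.isLinear.Build F countable_power A *:%R
  (coordinate i) (fun _ _ _ => erefl).

Lemma satisfies_power v : satisfies A v -> satisfies countable_power v.
Proof.
move=> Av e; apply/funext => i.
rewrite -[RHS](Av (coordinate i \o e)).
exact: (@morph_eval_poly _ _ _ (coordinate i) (fun _ _ => erefl)).
Qed.

Lemma foldl_one_sided_power (a : countable_power) t i :
  foldl (@one_sided _ countable_power) a t i
  = foldl (@one_sided _ A) (a i) [seq (s.1, s.2 i) | s <- t].
Proof. by elim: t a => //= -[[] b] t IHt a; rewrite IHt. Qed.

Lemma hyperannihilator_power_vanishing (w : nat -> bool) :
  (forall a, hyperannihilator (a : countable_power)) ->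
  exists n, vanishing A (mkseq w n).
Proof.
move=> Zall; apply: contrapT => nvan.
(* Coordinate n will witness that the prefix of length n does not vanish. *)
have /choice[c cP] n : exists c : A * seq (bool * A), map fst c.2 = mkseq w n
    /\ foldl (@one_sided _ A) c.1 c.2 <> 0.
  apply: contrapT => nex; apply: nvan; exists n => a t ts.
  by apply: contrapT => at0; apply: nex; exists (a, t).
pose a : countable_power := fun n => (c n).1.
(* [x i] gathers the [i]-th multipliers of all witnesses. The default 0 is harmless: coordinate [n]
   is read only for [i] below [n], the length of its witness. *)
pose x i : countable_power := fun n => (nth (true, 0) (c n).2 i).2.
(* The length [n] at which [a] is killed is also the coordinate to inspect. *)
have [n] := @hyperannihilator_finite _ _ a (fun i => (w i, x i)) (Zall a).
have [cw cn0] := cP n.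
move/(congr1 (@^~ n)); rewrite foldl_one_sided_power => a0; apply: cn0.
rewrite -[RHS]a0; congr foldl.
have szc : size (c n).2 = n by rewrite -(size_map fst) cw size_mkseq.
apply: (@eq_from_nth _ (true, 0)); rewrite ?size_map ?size_iota // szc => i i_n.
rewrite (nth_map (true, x 0%N)) ?size_map ?size_iota //.
rewrite (nth_map 0%N) ?size_iota // nth_iota //= add0n.
rewrite [LHS]surjective_pairing; congr pair.
by rewrite -(nth_map _ true) ?szc // cw nth_mkseq.
Qed.

End CountablePower.

(** * The two implications *)

Lemma nilpotent_annihilator (F : fieldType) (A : naAlgebra F) :
  nilpotent_alg A -> nonzero_alg A -> annihilator A <> [set 0].
Proof.
move=> [c [_ pc0]] [x xn0].
(* The index is shifted because [power A 0] is zero by convention. *)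
have ex : exists k, `[< power A k.+1 = [set 0] >] by exists c; apply/asboolP.
case: (ex_minnP ex) => -[/asboolP|k /asboolP pk0 kmin].
  rewrite power1 => /seteqP[/(_ x I) /= x0 _]; by rewrite x0 eqxx in xn0.
(* As [power A k.+2] is zero, [power A k.+1] lies in the annihilator, so it would vanish against
   minimality. *)
move=> ann0; suff /kmin : `[< power A k.+1 = [set 0] >] by rewrite ltnn.
apply/asboolP/seteqP; split=> a; last by move=> ->; exact: power_zero.
move=> pa; rewrite -ann0 => b; split.
  suff : power A k.+2 (na_mul A a b) by rewrite pk0.
  by rewrite -[k.+2]addn1; apply: power_mul => //; exact: power_one.
suff : power A k.+2 (na_mul A b a) by rewrite pk0.
by rewrite -[k.+2]add1n; apply: power_mul => //; exact: power_one.
Qed.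

Theorem theorem3 (F : fieldType) (V : naAlgebra F -> Prop) (hV : is_variety V) :
  nilpotent_variety V <->
  (forall A : naAlgebra F, V A -> nonzero_alg A -> annihilator A <> [set 0]).
Proof.
split=> [nilV A /nilV|annV A VA]; first exact: nilpotent_annihilator.
have [Sigma VE] := hV.
have hyperT B : V B -> forall a : B, hyperannihilator a.
  move=> VB; have [Q [p [pS pM pZ]]] := quotient_algebra (@hyper0 _ B)
    (@hyperD _ B) (@hyperZ _ B) (@hyperannihilator_ideal _ B).
  have VQ : V Q.
    by apply/VE => v Sv; apply: (satisfies_surj pM pS); exact: (VE B).1 VB v Sv.
  have annQ : annihilator Q = [set 0].
    apply/seteqP; split=> q; last by move=> -> b; rewrite linear0l linear0r.
    (* All products of the preimage [a] map to 0, so they lie in the kernel, and [hyper_step] puts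
       [a] there too. *)
    have [a <-] := pS q => pa; apply/pZ; apply: hyper_step => b; apply/pZ.
      by rewrite pM (pa (p b)).1.
    by rewrite pM (pa (p b)).2.
  move=> a; apply/pZ; apply: contrapT => pa; case: (annV Q VQ _ annQ).
  by exists (p a); apply/eqP.
have VP : V (countable_power A).
  by apply/VE => v Sv; apply: satisfies_power; exact: (VE A).1 VA v Sv.
have [n nvan] : exists n, forall s, size s = n -> vanishing A s.
  by apply: vanishing_uniform => w;
    exact: hyperannihilator_power_vanishing (hyperT _ VP).
exact: vanishing_nilpotent nvan.
Qed.
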